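(* Let $S$ be a Seidel matrix of order $n\geqslant277$ with $\lambda_{\min}(S)=-5$, $\alpha([S])\leqslant28$ and $\omega([S])=4$. Let $H$ be a graph in the switching class $[S]$ containing two adjacent vertices $x_1,x_2$ with no common neighbour, and let $\mathcal{Ga}(x_1,x_2)$ be the subgraph of $H$ induced on $U(x_1,x_2)=\{y\in V(H)\mid y\not\sim x_1,\ y\not\sim x_2\}$. For $y\in U(x_1,x_2)$ let $b_y$ be its valency in $\mathcal{Ga}(x_1,x_2)$, let $b_{\max}$ be the maximum valency of $\mathcal{Ga}(x_1,x_2)$ and let $\kappa=|U(x_1,x_2)|$. If $b_{\max}\leqslant20$, then (i) $\kappa\leqslant105$, and (ii) if $\kappa=105$, there is an edge $uv$ of $\mathcal{Ga}(x_1,x_2)$ with $b_u=b_v=20$.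
   Context: All graphs are finite, simple, undirected. A Seidel matrix of order $n$ is a real symmetric $n\times n$ matrix with zero diagonal and off-diagonal entries in $\{\pm1\}$; its graph $G(S)$ has vertex set $\{1,\dots,n\}$ with $i\sim j$ iff $S_{ij}=-1$. For $W\subseteq\{1,\dots,n\}$ let $D_W$ be diagonal with $(D_W)_{ii}=1$ if $i\in W$, $-1$ otherwise; the switching class $[S]$ is the set of graphs $G(D_WSD_W)$. The switching graph $\mathcal{Sw}(S)$ is $G(S')$ with $S'=\begin{pmatrix}S&-S+\mathbf{I}\\-S+\mathbf{I}&S\end{pmatrix}$; $\alpha([S]):=\alpha(\mathcal{Sw}(S))$ and $\omega([S]):=\omega(\mathcal{Sw}(S))$ (independence and clique numbers). $\lambda_{\min}$ is the smallest eigenvalue. *)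

(* Defs.v *)
From mathcomp Require Import all_boot all_order all_algebra.
From mathcomp Require Import reals.

Set Implicit Arguments.
Unset Strict Implicit.
Unset Printing Implicit Defensive.

Import Order.TTheory GRing.Theory Num.Theory.
Local Open Scope ring_scope.

Section Graphs.
Variables (T : finType) (e : rel T).

Definition independent (A : {set T}) : bool :=
  [forall x in A, forall y in A, ~~ e x y].

Definition clique (A : {set T}) : bool :=
  [forall x in A, forall y in A, (x != y) ==> e x y].

Definition independence_number : nat :=
  (\max_(A : {set T} | independent A) #|A|)%N.

Definition clique_number : nat :=
  (\max_(A : {set T} | clique A) #|A|)%N.

Definition valency (x : T) : nat := #|[set y | e x y]|.

Definition max_valency : nat := (\max_(x : T) valency x)%N.

Definition induced (A : {set T}) : rel {x : T | x \in A} :=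
  fun x y => e (val x) (val y).

(* Since [e] is irreflexive, an edge [x1 x2] has neither end in this set. *)
Definition common_nonneighbours (x1 x2 : T) : {set T} :=
  [set y | ~~ e y x1 & ~~ e y x2].

Definition nonneighbour_graph (x1 x2 : T) :
    rel {y : T | y \in common_nonneighbours x1 x2} :=
  @induced (common_nonneighbours x1 x2).

End Graphs.

Arguments induced {T} e A.
Arguments nonneighbour_graph {T} e x1 x2.

Section Seidel.
Variables (R : realType) (n : nat).
Implicit Types (S : 'M[R]_n) (W : {set 'I_n}).

Definition seidel S : Prop :=
  [/\ S^T = S,
      forall i, S i i = 0
    & forall i j, i != j -> S i j = 1 \/ S i j = -1].

Definition smallest_eigenvalue S (a : R) : Prop :=
  eigenvalue S a /\ forall b, eigenvalue S b -> a <= b.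

Definition seidel_graph S : rel 'I_n := fun i j => S i j == -1.

Definition switching_diag W : 'M[R]_n :=
  diag_mx (\row_i (if i \in W then 1 else -1)).

(* Graphs on the labelled vertex set ['I_n], identified up to [=2]. *)
Definition in_switching_class S (H : rel 'I_n) : Prop :=
  exists W, H =2 seidel_graph (switching_diag W *m S *m switching_diag W).

End Seidel.

Section SwitchingGraph.
Variables (R : realType) (n : nat) (S : 'M[R]_n).

Definition switching_graph : rel 'I_(n + n) :=
  seidel_graph (block_mx S (- S + 1%:M) (- S + 1%:M) S).

Definition class_independence_number : nat :=
  independence_number switching_graph.

Definition class_clique_number : nat := clique_number switching_graph.

End SwitchingGraph.

(* Main.v *)
(* Let Ga be the graph on U(x1, x2), A its adjacency matrix and L = A - 2I.
   Projecting S + 5I orthogonally to x1 + x2 gives 4 u^T L u <= (sum u)^2; the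
   clique number makes Ga triangle-free, and the independence number gives
   alpha(Ga) <= 27. These conditions are hereditary, so it suffices to exclude
   graphs on exactly 105 vertices with valencies at most 20; hence
   kappa <= 104 and part (ii) is vacuous.
   Since alpha <= 27, some vertex has valency at least 13. Let g maximise u^T L u
   on the standard simplex, with value theta: the bound above gives
   theta <= 1/4, a star with 13 leaves gives theta >= 1/6, and the deficiencies
   delta = theta - L g are nonnegative and vanish on the support of g.
   As L is negative semidefinite on vectors of sum zero, every u satisfies
     u^T L u <= theta (sum u)^2 - 2 (sum u) <u, delta>.
   Applying this to the star of every vertex y (with weight 2/5 of the valency on
   the centre), averaging over y with respect to g, and applying it once more to
   u = delta, leaves a system of inequalities in theta, sum delta and
   sum delta^2 which has no solution when the mean valency is at most 20. *)

Require Import Defs.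
From mathcomp Require Import all_boot all_order all_algebra.
From mathcomp Require Import reals.
From mathcomp Require classical_sets topology normedtype derive.
From mathcomp Require Import ring lra zify.

Set Implicit Arguments.
Unset Strict Implicit.
Unset Printing Implicit Defensive.

Import Order.TTheory GRing.Theory Num.Theory.
Local Open Scope ring_scope.

(** * Quadratic forms on row vectors *)

Section BilinearForm.
Variables (R : comNzRingType) (n : nat) (Q : 'M[R]_n).
Implicit Types u v w : 'rV[R]_n.

Definition bil u v : R := (u *m Q *m v^T) 0 0.

Lemma bilE u v : bil u v = \sum_i \sum_j u 0 i * Q i j * v 0 j.
Proof.
rewrite /bil mxE exchange_big; apply: eq_bigr => j _ /=.
by rewrite !mxE mulr_suml.
Qed.

Lemma bilDl u v w : bil (u + v) w = bil u w + bil v w.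
Proof. by rewrite /bil !mulmxDl mxE. Qed.

Lemma bilDr u v w : bil u (v + w) = bil u v + bil u w.
Proof. by rewrite /bil linearD mulmxDr mxE. Qed.

Lemma bilZl a u v : bil (a *: u) v = a * bil u v.
Proof. by rewrite /bil -!scalemxAl mxE. Qed.

Lemma bilZr a u v : bil u (a *: v) = a * bil u v.
Proof. by rewrite /bil linearZ -scalemxAr mxE. Qed.

Lemma bilC u v : Q^T = Q -> bil u v = bil v u.
Proof.
move=> Qsym; rewrite /bil -[u *m Q *m v^T]trmxK mxE !trmx_mul trmxK Qsym.
by rewrite mulmxA.
Qed.

Lemma bil_addZ c u v : Q^T = Q ->
  bil (u + c *: v) (u + c *: v) = bil u u + 2 * c * bil u v + c ^+ 2 * bil v v.
Proof.
by move=> Qsym; rewrite bilDl !bilDr !bilZl !bilZr (bilC v u Qsym); ring.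
Qed.

Definition coordsum u : R := \sum_i u 0 i.

Lemma coordsumD u v : coordsum (u + v) = coordsum u + coordsum v.
Proof. by rewrite /coordsum -big_split; apply: eq_bigr => i _; rewrite mxE. Qed.

Lemma coordsumZ a u : coordsum (a *: u) = a * coordsum u.
Proof. by rewrite /coordsum mulr_sumr; apply: eq_bigr => i _; rewrite mxE. Qed.

Definition ind (A : {set 'I_n}) : 'rV[R]_n := \row_i (i \in A)%:R.

Lemma sum_ind (A : {set 'I_n}) (F : 'I_n -> R) :
  \sum_i (ind A) 0 i * F i = \sum_(i in A) F i.
Proof.
rewrite [RHS]big_mkcond; apply: eq_bigr => i _.
by rewrite mxE; case: ifP => _; rewrite ?mul1r ?mul0r.
Qed.

Lemma coordsum_ind A : coordsum (ind A) = #|A|%:R.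
Proof.
rewrite /coordsum (eq_bigr (fun i => ind A 0 i * 1)) => [|i _]; last by rewrite mulr1.
by rewrite sum_ind sumr_const.
Qed.

Lemma bil_ind A C : bil (ind A) (ind C) = \sum_(i in A) \sum_(j in C) Q i j.
Proof.
rewrite bilE -sum_ind; apply: eq_bigr => i _.
rewrite -sum_ind mulr_sumr; apply: eq_bigr => j _.
by rewrite -mulrA [Q i j * _]mulrC.
Qed.

Definition sqnorm u : R := \sum_i u 0 i ^+ 2.

End BilinearForm.

Arguments ind {R n}.
Arguments coordsum {R n}.
Arguments sqnorm {R n}.

(** * Attained extrema of quadratic forms *)

(* The imports are local to the section: classical_sets would shadow finset. *)
Section Compactness.
Import classical_sets topology normedtype derive.
Import numFieldNormedType.Exports.

Section Extrema.
Variables (R : realType) (n : nat) (Q : 'M[R]_n).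
Local Open Scope classical_set_scope.

Lemma continuous_sum_fun (F : 'I_n -> 'rV[R]_n -> R) :
  (forall i, continuous (F i)) -> continuous (fun u => \sum_i F i u).
Proof.
by move=> Fc; apply: continuous_big => // -[x y]; exact: add_continuous.
Qed.

Lemma continuous_bil : continuous (fun u => bil Q u u).
Proof.
have -> : (fun u => bil Q u u) = fun u => \sum_i \sum_j u 0 i * Q i j * u 0 j.
  by apply/boolp.funext => u; rewrite bilE.
apply: continuous_sum_fun => i; apply: continuous_sum_fun => j u.
apply: (@continuousM _ _ (fun u : 'rV[R]_n => u 0 i * Q i j) (fun u => u 0 j)).
  apply: (@continuousM _ _ (fun u : 'rV[R]_n => u 0 i) (fun=> Q i j)).
    exact: coord_continuous.
  exact: cst_continuous.
exact: coord_continuous.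
Qed.

(** The bound on coordinates puts [K] inside the compact cube [-1, 1]^n. *)
Lemma bil_max (K : set 'rV[R]_n) :
  K !=set0 -> closed K -> (forall u i, K u -> `|u 0 i| <= 1) ->
  exists2 g, K g & forall u, K u -> bil Q u u <= bil Q g g.
Proof.
move=> K0 Kcl Kbd.
have Kc : compact K.
  have cube : compact [set v : 'rV[R]_n | forall i, `[(-1 : R), 1]%classic (v ord0 i)].
    apply: (@rV_compact _ _ (fun=> `[(-1 : R), 1]%classic)) => _.
    exact: segment_compact.
  apply: subclosed_compact Kcl cube _ => v Kv i /=.
  by rewrite in_itv /= -ler_norml Kbd.
have [|g gK gmax] := @EVT_max_rV R n (fun u => bil Q u u) K K0 Kc.
  by apply: continuous_subspaceT; exact: continuous_bil.
by exists g => [|u Ku]; [exact: set_mem | apply/gmax/mem_set].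
Qed.

End Extrema.

Lemma simplex_max (R : realType) (n : nat) (Q : 'M[R]_n) : (0 < n)%N ->
  exists g : 'rV[R]_n, [/\ forall i, 0 <= g 0 i, coordsum g = 1 &
    forall u : 'rV[R]_n, (forall i, 0 <= u 0 i) -> coordsum u = 1 -> bil Q u u <= bil Q g g].
Proof.
case: n Q => // n Q _.
pose K : set 'rV[R]_n.+1 := [set u : 'rV[R]_n.+1 | (forall i, 0 <= u 0 i) /\ coordsum u = 1]%classic.
have [|||g [g0 g1] gmax] := @bil_max R n.+1 Q K; last 1 first.
- by exists g; split=> // u u0 u1; apply: gmax.
- exists (ind [set ord0]); split => [i|]; first by rewrite mxE ler0n.
  by rewrite coordsum_ind cards1.
- have -> : K = ((\bigcap_(i in setT) ((fun u : 'rV[R]_n.+1 => u 0 i) @^-1` [set x | 0 <= x]))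
      `&` (coordsum @^-1` [set 1]))%classic.
    apply/seteqP; split => u /= [] u0 u1; split=> // i; first by move=> _; exact: u0.
    exact: u0.
  apply: closedI.
    apply: closed_bigI => i _; apply: preimage_closed; last exact: closed_ge.
    by move=> u _; exact: coord_continuous.
  apply: preimage_closed; last exact: closed_eq.
  by move=> u _; apply: continuous_sum_fun => i; exact: coord_continuous.
- move=> u i [u0 u1]; rewrite ger0_norm // -u1 /coordsum (bigD1 i) //= lerDl.
  by apply: sumr_ge0.
Qed.

Lemma sphere_min (R : realType) (n : nat) (Q : 'M[R]_n) : (0 < n)%N ->
  exists2 x : 'rV[R]_n, sqnorm x = 1 &
    forall u : 'rV[R]_n, sqnorm u = 1 -> bil Q x x <= bil Q u u.
Proof.
case: n Q => // n Q _.
pose K : set 'rV[R]_n.+1 := [set u : 'rV[R]_n.+1 | sqnorm u = 1]%classic.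
have bilN u : bil (- Q) u u = - bil Q u u.
  by rewrite /bil mulmxN mulNmx mxE.
have [|||g g1 gmax] := @bil_max R n.+1 (- Q) K; last 1 first.
- by exists g => // u /gmax; rewrite !bilN lerN2.
- exists (ind [set ord0]); rewrite /K /= /sqnorm (bigD1 ord0) //= big1 => [|i /negPf i0].
    by rewrite mxE inE eqxx expr1n addr0.
  by rewrite mxE inE i0 expr0n.
- apply: (@preimage_closed _ _ (@sqnorm R n.+1) [set 1]%classic); last exact: closed_eq.
  move=> u _; apply: continuous_sum_fun => i v.
  by apply: (@continuousM _ _ (fun u : 'rV[R]_n.+1 => u 0 i) (fun u => u 0 i));
    exact: coord_continuous.
- move=> u i u1; have : `|u 0 i| ^+ 2 <= 1 ^+ 2.
    rewrite expr1n -u1 real_normK ?num_real // /sqnorm (bigD1 i) //= lerDl.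
    by apply: sumr_ge0 => j _; exact: sqr_ge0.
  by rewrite ler_pXn2r // nnegrE.
Qed.

End Compactness.

(** * The smallest eigenvalue as the minimum of the Rayleigh quotient *)

Lemma bil_suml (R : comNzRingType) n (Q : 'M[R]_n) (I : finType) (c : I -> R) (v : I -> 'rV[R]_n) w :
  bil Q (\sum_i c i *: v i) w = \sum_i c i * bil Q (v i) w.
Proof.
rewrite /bil !mulmx_suml summxE; apply: eq_bigr => i _.
by rewrite -!scalemxAl mxE.
Qed.

Lemma bil_sumr (R : comNzRingType) n (Q : 'M[R]_n) (I : finType) (c : I -> R) (v : I -> 'rV[R]_n) w :
  bil Q w (\sum_i c i *: v i) = \sum_i c i * bil Q w (v i).
Proof.
rewrite /bil linear_sum mulmx_sumr summxE; apply: eq_bigr => i _.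
by rewrite linearZ -scalemxAr mxE.
Qed.

Lemma sqnorm_ge0 (R : realDomainType) n (u : 'rV[R]_n) : 0 <= sqnorm u.
Proof. by apply: sumr_ge0 => i _; exact: sqr_ge0. Qed.

Lemma sqnorm_eq0 (R : realDomainType) n (u : 'rV[R]_n) : (sqnorm u == 0) = (u == 0).
Proof.
apply/eqP/eqP => [u0|->]; last first.
  by apply: big1 => i _; rewrite mxE expr0n.
apply/rowP => i; rewrite mxE; apply/eqP; rewrite -sqrf_eq0.
by rewrite (psumr_eq0P _ u0) // => j _; exact: sqr_ge0.
Qed.

Lemma sqnormZ (R : comNzRingType) n a (u : 'rV[R]_n) : sqnorm (a *: u) = a ^+ 2 * sqnorm u.
Proof. by rewrite /sqnorm mulr_sumr; apply: eq_bigr => i _; rewrite mxE exprMn. Qed.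

Lemma sqnormE (R : comNzRingType) n (u : 'rV[R]_n) : sqnorm u = bil 1%:M u u.
Proof. by rewrite /bil mulmx1 mxE; apply: eq_bigr => i _; rewrite mxE expr2. Qed.

Lemma quadratic_linear_eq0 (R : realFieldType) (a b : R) :
  (forall t, 0 <= t ^+ 2 * a + 2 * t * b) -> b = 0.
Proof.
move=> h; apply/eqP; case: (eqVneq b 0) => // b0; exfalso.
(* At t = -b/c the expression equals (b/c)^2 (a - 2c), negative because c > |a|. *)
pose c := `|a| + 1; have ac : a < c by rewrite (le_lt_trans (ler_norm a)) // ltrDl.
have c0 : 0 < c by rewrite ltr_wpDl.
have := h (- b / c).
have -> : (- b / c) ^+ 2 * a + 2 * (- b / c) * b = (b / c) ^+ 2 * (a - 2 * c).
  by field; exact: lt0r_neq0.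
rewrite pmulr_rge0; first by lra.
by rewrite exprn_even_gt0 //= mulf_neq0 // invr_eq0 lt0r_neq0.
Qed.

(** A minimiser of the form on the unit sphere is an eigenvector, so the minimum [m] is an
    eigenvalue and [a <= m]. *)
Lemma smallest_eigenvalue_bound (R : realType) n (S : 'M[R]_n) (a : R) :
  S^T = S -> smallest_eigenvalue S a -> forall u, a * sqnorm u <= bil S u u.
Proof.
move=> Ssym [_ amin] u.
case: (posnP n) => [n0|n0].
  subst n; rewrite /sqnorm bilE !big_ord0; lra.
have [x x1 xmin] := sphere_min S n0.
set m := bil S x x.
have Pge0 v : 0 <= bil S v v - m * sqnorm v.
  case: (eqVneq v 0) => [->|v0].
    by rewrite (_ : sqnorm 0 = 0) ?bilE; [rewrite big1 ?mulr0 ?subr0 // => i _; rewrite big1 // => j _; rewrite mxE !mul0r|apply/eqP; rewrite sqnorm_eq0].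
  have nv : 0 < sqnorm v by rewrite lt_def sqnorm_eq0 v0 sqnorm_ge0.
  have sv : 0 < Num.sqrt (sqnorm v) by rewrite sqrtr_gt0.
  have := xmin ((Num.sqrt (sqnorm v))^-1 *: v).
  rewrite sqnormZ exprVn sqr_sqrtr ?sqnorm_ge0 // mulVf ?gt_eqF // => /(_ erefl).
  rewrite bilZl bilZr mulrA -expr2 exprVn sqr_sqrtr ?sqnorm_ge0 // -/m.
  by rewrite mulrC ler_pdivlMr // subr_ge0.
(* [w] is the residual of the eigenvector equation. The form of S - m is nonnegative and vanishes at
   [x], so its linear term in direction [w], which is [sqnorm w], must vanish. *)
have [w wE] : {w | w = x *m S - m *: x} by eexists.
have w0 : w = 0.
  apply/eqP; rewrite -sqnorm_eq0; apply/eqP.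
  apply: (@quadratic_linear_eq0 _ (bil S w w - m * bil 1%:M w w)) => t.
  have := Pge0 (x + t *: w).
  have -> : sqnorm w = bil S x w - m * bil 1%:M x w.
    by rewrite sqnormE {1}wE /bil !mulmx1 mulmxBl -scalemxAl mxE [X in _ + X]mxE [in X in _ + X]mxE.
  rewrite !sqnormE !(bilDl, bilDr, bilZl, bilZr). 
  rewrite (bilC w x Ssym) -/m.
  rewrite (bilC w x (trmx1 _ _)) -[bil 1%:M x x]sqnormE x1.
  by lra.
have /amin am : eigenvalue S m.
  apply/eigenvalueP; exists x; first by apply/eqP; rewrite -subr_eq0 -wE w0.
  by rewrite -sqnorm_eq0 x1 oner_eq0.
have := Pge0 u; have := sqnorm_ge0 u; have : 0 <= (m - a) * sqnorm u.
  by rewrite mulr_ge0 ?subr_ge0 // sqnorm_ge0.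
lra.
Qed.

(** * Large independent sets and edge counting *)

Section IndependentSets.
Variables (T : finType) (e : rel T).
Hypotheses (esym : symmetric e) (eirr : irreflexive e).
Implicit Types A B I J : {set T}.
Local Open Scope nat_scope.

Definition nbrs (x : T) : {set T} := [set y | e x y].

(** Ordered pairs are counted, so [edges A A] is twice the number of edges inside [A]. *)
Definition edges A B : nat := \sum_(x in A) #|nbrs x :&: B|.

Lemma edgesE A B : edges A B = \sum_(x in A) \sum_(y in B) e x y.
Proof.
apply: eq_bigr => x _; rewrite -sum1_card big_mkcond [RHS]big_mkcond /=.
by apply: eq_bigr => y _; rewrite !inE; case: (e x y); case: (y \in B).
Qed.

Lemma edgesC A B : edges A B = edges B A.
Proof.
rewrite !edgesE exchange_big; apply: eq_bigr => y _.
by apply: eq_bigr => x _; rewrite esym.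
Qed.

Lemma independentP A :
  reflect {in A &, forall x y, ~~ e x y} (independent e A).
Proof.
apply: (iffP forall_inP) => [h x y xA yA|h x xA].
  exact: (forall_inP (h x xA)).
by apply/forall_inP => y yA; exact: h.
Qed.

Lemma edges_independent A : independent e A -> edges A A = 0.
Proof.
move/independentP => Aind; rewrite edgesE big1 // => x xA.
by rewrite big1 // => y yA; rewrite (negPf (Aind x y xA yA)).
Qed.

Lemma independentU1 x A :
  independent e A -> nbrs x :&: A = set0 -> independent e (x |: A).
Proof.
move=> /independentP Aind xA.
have nxA y : y \in A -> ~~ e x y.
  by move=> yA; move/setP/(_ y): xA; rewrite !inE yA andbT => ->.
apply/independentP => y z; rewrite !inE.
case/orP => [/eqP->|yA] /orP[/eqP->|zA]; rewrite ?eirr //.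
- exact: nxA.
- by rewrite esym nxA.
- exact: Aind.
Qed.

Lemma maximum_independent A :
  exists I, [/\ I \subset A, independent e I,
    forall J, J \subset A -> independent e J -> #|J| <= #|I| &
    forall x, x \in A :\: I -> 0 < #|nbrs x :&: I|].
Proof.
pose P (I : {set T}) := (I \subset A) && independent e I.
have P0 : P set0.
  by rewrite /P sub0set; apply/independentP => x y; rewrite inE.
case: (@arg_maxnP _ set0 P (fun I : {set T} => #|I|) P0) => I /andP[IA Iind] Imax.
exists I; split=> // [J JA Jind|x]; first by apply: Imax; rewrite /P JA.
rewrite inE => /andP[xI xA]; rewrite card_gt0; apply/negP => /eqP xI0.
have := Imax (x |: I); rewrite /P subUset sub1set xA IA independentU1 //.
by move=> /(_ isT); rewrite /geq /= cardsU1 xI; lia.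
Qed.

(** Each vertex of [A] outside a maximum independent [I] sends an edge to [I], and [edges A A]
    counts that edge twice. *)
Lemma large_independent_subset A :
  exists I, [/\ I \subset A, independent e I & 2 * #|A| <= 2 * #|I| + edges A A].
Proof.
have [I [IA Iind _ Idom]] := maximum_independent A.
exists I; split=> //.
have AI : #|A| = #|I| + #|A :\: I| by rewrite -(cardsID I A) (setIidPr IA).
have split_edges B : edges A B = edges I B + edges (A :\: I) B.
  by rewrite /edges (big_setID I) /= (setIidPr IA).
have dom : #|A :\: I| <= edges (A :\: I) I.
  by rewrite -sum1_card; apply: leq_sum => x /Idom.
have : edges A A >= edges A I + edges A (A :\: I).
  by rewrite [edges A I]edgesC [edges A (A :\: I)]edgesC [leqRHS]split_edges.
rewrite !split_edges [edges I (A :\: I)]edgesC; lia.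
Qed.

(** Count the edges between a maximum independent [I] and its complement. Outside vertices send at
    least two each, except those of [P], which send one and number at most |I|; hence 2(|T| - |I|)
    <= (d + 1)|I|. *)
Lemma triangle_free_card_bound (d : nat) :
  (forall x y z, e x y -> e y z -> ~~ e x z) ->
  (forall x, #|nbrs x| <= d) ->
  exists I, independent e I /\ 2 * #|T| <= (d + 3) * #|I|.
Proof.
move=> trif deg.
have [I [_ Iind Imax Idom]] := maximum_independent [set: T].
exists I; split=> //.
pose P := [set x in ~: I | #|nbrs x :&: I| == 1].
have PI : #|P| <= #|I|.
  (* The only neighbour of [x] in [I]; for [x] in [P] the default is never returned. *)
  pose f x := odflt x [pick i in nbrs x :&: I].
  have fP x : x \in P -> nbrs x :&: I = [set f x].
    rewrite inE => /andP[_ /cards1P[i xi]]; rewrite /f xi.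
    by case: pickP => [j /set1P -> //|/(_ i)]; rewrite !inE eqxx.
  (* If x and y in [P] shared their neighbour i, they would be nonadjacent by triangle-freeness, and
     exchanging i for both would enlarge [I]. *)
  have finj : {in P &, injective f}.
    move=> x y xP yP fxy; apply/eqP/negPn/negP => xy.
    have [fx fy] := (fP x xP, fP y yP); rewrite -fxy in fy.
    set i := f x in fx fy.
    have iI : i \in I by have := set11 i; rewrite -fx inE => /andP[].
    have xi : e x i by have := set11 i; rewrite -fx !inE => /andP[].
    have yi : e y i by have := set11 i; rewrite -fy !inE => /andP[].
    have [xI yI] : x \notin I /\ y \notin I.
      by move: xP yP; rewrite !inE => /andP[-> _] /andP[-> _].
    have disj z : nbrs z :&: I = [set i] -> nbrs z :&: (I :\ i) = set0.
      by move=> zi; rewrite setIDA zi setDv.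
    have J1 : independent e (y |: I :\ i).
      apply: independentU1; last exact: disj.
      apply/independentP => a b /setD1P[_ aI] /setD1P[_ bI].
      exact: (independentP _ Iind).
    have J2 : independent e (x |: (y |: I :\ i)).
      apply: independentU1 => //; rewrite setIUr disj // setU0.
      apply/setP => z; rewrite !inE; apply/negP => /andP[xz /eqP zy].
      by subst z; have := trif x y i xz yi; rewrite xi.
    have := Imax _ (subsetT _) J2.
    have yJ : y \notin I :\ i by rewrite !inE negb_and yI orbT.
    have xJ : x \notin y |: I :\ i by rewrite !inE negb_or xy negb_and xI orbT.
    by rewrite !cardsU1 yJ xJ (cardsD1 i I) iI; lia.
  rewrite -(card_in_imset finj); apply: subset_leq_card.
  apply/subsetP => _ /imsetP[x xP ->].
  by have := set11 (f x); rewrite -(fP x xP) inE => /andP[].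
have lower : 2 * #|~: I| <= edges (~: I) I + #|P|.
  rewrite -sum1_card -sum1_card big_distrr /= /edges.
  rewrite [X in _ <= _ + X](big_setID (~: I)) /=.
  rewrite [X in _ + (_ + X)]big1 ?addn0; last first.
    by move=> x; rewrite !inE; case: (x \in I).
  have -> : P :&: ~: I = [set x in ~: I | x \in P].
    by apply/setP => x; rewrite !inE andbC.
  rewrite big_set /= [X in _ + X]big_mkcondr -big_split /=.
  apply: leq_sum => x xI; have := Idom x; rewrite setTD xI => /(_ isT).
  by move: xI; rewrite !inE => ->; rewrite /=; case: eqP; lia.
have upper : edges (~: I) I <= d * #|I|.
  rewrite edgesC -sum1_card big_distrr /=; apply: leq_sum => x _.
  by rewrite muln1 (leq_trans _ (deg x)) // subset_leq_card // subsetIl.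
have := cardsC I; rewrite mulnDl; lia.
Qed.

End IndependentSets.

Lemma exists_subset_card (T : finType) (A : {set T}) (k : nat) :
  (k <= #|A|)%N -> exists B : {set T}, B \subset A /\ #|B| = k.
Proof.
move=> /card_geqP[s [us ss sA]]; exists [set x in s]; split.
  by apply/subsetP => x; rewrite inE => /sA.
by rewrite cardsE -ss; exact/card_uniqP.
Qed.

Lemma leq_card_bigcup (I T : finType) (A : {set I}) (F : I -> {set T}) :
  (#|\bigcup_(i in A) F i| <= \sum_(i in A) #|F i|)%N.
Proof.
elim/big_rec2: _ => [|i k B _ IH]; first by rewrite cards0.
by apply: leq_trans (leq_card_setU _ _) _; rewrite leq_add2l.
Qed.

(** * Real inequalities for the optimisation argument *)

Lemma first_order_condition (R : realFieldType) (a b c : R) :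
  (forall t, 0 <= t <= 1 -> (1 - t) ^+ 2 * a + 2 * (1 - t) * t * b + t ^+ 2 * c <= a) ->
  b <= a.
Proof.
move=> h; rewrite leNgt; apply/negP => ab.
pose d := b - a; have d0 : 0 < d by rewrite subr_gt0.
have q0 := normr_ge0 (a - c); have q1 := ler_norm (a - c).
(* The hypothesis reads t (2d - t (2d + a - c)) <= 0. The choice t = d/D makes the subtracted term
   at most d, leaving a positive product. *)
pose D := 2 * d + `|a - c|; have D0 : 0 < D by rewrite /D; lra.
pose t := d / D; have t0 : 0 < t by rewrite divr_gt0.
have tD : t * D = d by rewrite /t divfK // gt_eqF.
have t1 : t <= 1 by rewrite ler_pdivrMr // /D; lra.
have {h} := h t; rewrite t1 ltW // => /(_ isT) h.
have h1 : t * (2 * d - t * (2 * d + (a - c))) <= 0 by rewrite /d; lra.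
rewrite pmulr_rle0 // in h1.
have h2 : 0 <= t * (`|a - c| - (a - c)) by apply: mulr_ge0; [exact: ltW | rewrite subr_ge0].
rewrite /D in tD; lra.
Qed.

(* [t], [x], [y] stand for theta, sum delta and (sum delta^2) / theta. *)
Lemma deficiency_infeasible (R : realFieldType) (t x y : R) :
  1/6 <= t -> t <= 1/4 -> y <= x -> 105*t - 18 <= x ->
  (12-49*t)*(2+105*t-x) + 70*t*(x-y) <= 50 ->
  0 <= 2*y+x^+2-2*x*y -> False.
Proof.
move=> t1 t2 yx h1 h2 h3.
have m0 : 0 <= t * (x-y) by apply: mulr_ge0; lra.
(* The averaged inequality becomes 70ty >= (119t - 12)x + c, and the last hypothesis (2x - 2)y <=
   x^2. Once x > 2, eliminating y gives (168t - 24)x^2 + (2c - 238t + 24)x - 2c <= 0. Each case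
   refutes this by expanding the quadratic about a lower bound for x. *)
set c := (12-49*t)*(2+105*t) - 50.
(* Up to 39/200 the quantity 105t(12 - 49t) - 50 is positive, which forces x > 2. Beyond it, 105t -
   18 already exceeds 2 and serves as the expansion point. *)
have [ht|ht] := lerP t (39/200).
  have r0 : 0 < c - 2*(12-49*t).
    have : 0 <= (t-1/6)*(39/200-t) by apply: mulr_ge0; lra.
    by rewrite /c; lra.
  have x2 : 2 < x.
    rewrite ltNge; apply/negP => x2.
    have : 0 <= (12-49*t)*(2-x) by apply: mulr_ge0; lra.
    by rewrite /c in r0; lra.
  have P : 0 <= (2*x-2) * (70*t*y - ((119*t-12)*x + c)).
    by apply: mulr_ge0; rewrite /c; lra.
  have V : 0 <= (70*t) * (2*y+x^+2-2*x*y) by apply: mulr_ge0 => //; lra.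
  have q1 : 0 <= (168*t-24)*(x-2)^+2 by apply: mulr_ge0; [lra|exact: sqr_ge0].
  have q2 : 0 < (140*t-2*(12-49*t)+2*(c - 2*(12-49*t)))*(x-2).
    by apply: mulr_gt0; lra.
  by lra.
have x2 : 2 < x by lra.
have P : 0 <= (2*x-2) * (70*t*y - ((119*t-12)*x + c)).
  by apply: mulr_ge0; rewrite /c; lra.
have V : 0 <= (70*t) * (2*y+x^+2-2*x*y) by apply: mulr_ge0 => //; lra.
have t0 : 0 <= t - 39/200 by lra.
have t0' := sqr_ge0 (t - 39/200).
have q1 : 0 < (168*t-24)*(105*t-18)^+2 + (2*c-238*t+24)*(105*t-18) - 2*c.
  (* With s = t - 39/200, the cubic minus 771750 s (s - 11/500)^2 has positive coefficients in s. *)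
  have := mulr_ge0 t0 (sqr_ge0 (t - 39/200 - 11/500)).
  by rewrite /c; lra.
have q2 : 0 <= 2*(168*t-24)*(105*t-18) + (2*c-238*t+24) by rewrite /c; lra.
have q3 : 0 <= (168*t-24)*(x-(105*t-18))^+2.
  by apply: mulr_ge0; [lra | exact: sqr_ge0].
have q4 : 0 <= (2*(168*t-24)*(105*t-18) + (2*c-238*t+24)) * (x-(105*t-18)).
  by apply: mulr_ge0; lra.
by lra.
Qed.

(** * The form A - 2I on a triangle-free graph, and the exclusion of 105 vertices *)

Section Laplacian.
Variables (R : realType) (m : nat) (e : rel 'I_m).
Hypotheses (esym : symmetric e) (eirr : irreflexive e).

Definition shifted_adj : 'M[R]_m := \matrix_(i, j) ((e i j)%:R - 2 * (i == j)%:R).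
Local Notation L := shifted_adj.
Local Notation N := (nbrs e).

Lemma shifted_adj_sym : L^T = L.
Proof. by apply/matrixP => i j; rewrite !mxE esym eq_sym. Qed.

Lemma sum_adj (F : 'I_m -> R) i : \sum_j (e i j)%:R * F j = \sum_(j in N i) F j.
Proof.
rewrite [RHS]big_mkcond; apply: eq_bigr => j _; rewrite inE.
by case: (e i j); rewrite ?mul1r ?mul0r.
Qed.

Lemma shifted_adjE i (v : 'rV[R]_m) :
  \sum_j L i j * v 0 j = \sum_(j in N i) v 0 j - 2 * v 0 i.
Proof.
under eq_bigr do rewrite mxE mulrBl.
rewrite sumrB sum_adj; congr (_ - _).
rewrite (bigD1 i) //= eqxx mulr1 big1 ?addr0 // => j /negPf ji.
by rewrite eq_sym ji mulr0 mul0r.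
Qed.

Lemma bil_shifted_adj (u v : 'rV[R]_m) :
  bil L u v = \sum_i u 0 i * (\sum_(j in N i) v 0 j - 2 * v 0 i).
Proof.
rewrite bilE; apply: eq_bigr => i _; rewrite -shifted_adjE mulr_sumr.
by apply: eq_bigr => j _; rewrite mulrA.
Qed.

Lemma sum_ind_card (A B : {set 'I_m}) :
  \sum_(i in A) (ind B : 'rV[R]_m) 0 i = #|A :&: B|%:R.
Proof.
rewrite -sum1_card natr_sum big_mkcond [RHS]big_mkcond.
by apply: eq_bigr => i _; rewrite mxE in_setI; case: (i \in A); case: (i \in B).
Qed.

Lemma bil_shifted_adj_ind (A B : {set 'I_m}) :
  bil L (ind A) (ind B) = (edges e A B)%:R - 2 * #|A :&: B|%:R.
Proof.
rewrite bil_shifted_adj sum_ind sumrB -mulr_sumr sum_ind_card /edges natr_sum.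
by congr (_ - _); apply: eq_bigr => i _; rewrite sum_ind_card.
Qed.

Hypothesis trif : forall x y z, e x y -> e y z -> ~~ e x z.

Lemma nbrs_independent x (A : {set 'I_m}) : A \subset N x -> independent e A.
Proof.
move=> /subsetP Ax; apply/independentP => y z /Ax xy /Ax xz.
by rewrite !inE in xy xz; apply: (trif (y := x)); rewrite // esym.
Qed.

Lemma bil_star x (A : {set 'I_m}) (a b : R) : A \subset N x ->
  let u := a *: ind [set x] + b *: ind A in
  bil L u u = 2 * a * b * #|A|%:R - 2 * a ^+ 2 - 2 * b ^+ 2 * #|A|%:R.
Proof.
move=> Ax /=; have xA : x \notin A.
  by apply/negP => /(subsetP Ax); rewrite inE eirr.
rewrite !(bilDl, bilDr, bilZl, bilZr) (bilC (ind A) _ shifted_adj_sym).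
rewrite !bil_shifted_adj_ind (edges_independent (nbrs_independent Ax)).
rewrite /edges !big_set1 (setIidPr Ax).
have -> : N x :&: [set x] = set0.
  by apply/setP => y; rewrite !inE; case: eqP => [->|]; rewrite ?eirr ?andbF.
have -> : [set x] :&: A = set0.
  by apply/setP => y; rewrite !inE; case: eqP => [->|]; rewrite ?(negPf xA).
rewrite !setIid cards0 cards1; ring.
Qed.

Hypothesis psd : forall u, 4 * bil L u u <= coordsum u ^+ 2.

(* Testing the form on the weights 7, 3 and -18/|T0| shows that the vertices T0
   far from a five-leaf star span few edges, hence a large independent set. *)
Lemma far_from_star (k : nat) x (A T0 : {set 'I_m}) :
  (forall I, independent e I -> (#|I| <= k)%N) ->
  A \subset N x -> #|A| = 5%N -> (forall y, y \in x |: A -> [disjoint N y & T0]) ->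
  [disjoint x |: A & T0] -> (#|T0| ^ 2 <= 36 * (k - 5))%N.
Proof.
move=> indk Ax A5 farN far.
have [->|T0n] := posnP #|T0|; first by [].
set t : R := #|T0|%:R; have t0 : 0 < t by rewrite ltr0n.
have farE (B : {set 'I_m}) : B \subset x |: A -> (edges e B T0 = 0%N) /\ (B :&: T0 = set0).
  move=> /subsetP BF; split.
    rewrite /edges big1 // => y /BF /farN; rewrite -setI_eq0 => /eqP ->.
    by rewrite cards0.
  apply/eqP; rewrite setI_eq0; apply: disjointWl far; exact/subsetP.
have [ex ix] := farE [set x] (subsetUl _ _).
have [eA iA] := farE A (subsetUr _ _).
(* The star has both form value and total weight 22. Adding total weight -18 on [T0] leaves weight
   4, so [psd] bounds the combined value by 4; this gives [#|T0| ^ 2 + 18 * E <= 36 * #|T0|]. *)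
pose u : 'rV[R]_m := 7 *: ind [set x] + 3 *: ind A.
have uL : bil L u u = 22 by rewrite /u bil_star // A5; ring.
have uT0 : bil L u (ind T0) = 0.
  by rewrite /u bilDl !bilZl !bil_shifted_adj_ind ex ix eA iA cards0; ring.
have := psd (u + (- 18 / t) *: ind T0).
rewrite bil_addZ ?shifted_adj_sym // uT0 uL bil_shifted_adj_ind setIid -/t.
rewrite /u !(coordsumD, coordsumZ) !coordsum_ind cards1 A5 -/t.
have [I [IT0 Iind It]] := large_independent_subset esym eirr T0.
set E := edges e T0 T0 in It *.
(* [T0] has no neighbour in the star, so [I] together with the five leaves is independent. *)
have IA5 : (#|I| + 5 <= k)%N.
  rewrite -A5 -(cardsUI I A).
  have -> : I :&: A = set0.
    apply/eqP; rewrite -subset0 -iA setIC; exact: setIS.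
  rewrite cards0 addn0; apply: indk; apply/independentP => y z.
  have nAI y' z' : y' \in A -> z' \in I -> ~~ e y' z'.
    move=> yA zI; have := farN y'; rewrite !inE yA orbT => /(_ isT) /pred0P /(_ z').
    by rewrite /= !inE (subsetP IT0 _ zI) andbT => ->.
  rewrite !inE => /orP[yI|yA] /orP[zI|zA].
  - exact: (independentP _ _ Iind).
  - by rewrite esym nAI.
  - exact: nAI.
  - exact: (independentP _ _ (nbrs_independent Ax)).
have -> : 7 * 1 + 3 * 5%:R + -18 / t * t = 4 :> R by field; exact: lt0r_neq0.
have -> : 22 + 2 * (-18 / t) * 0 + (-18 / t) ^+ 2 * (E%:R - 2 * t) =
   22 + 324 / t ^+ 2 * (E%:R - 2 * t) :> R by field; exact: lt0r_neq0.
move=> h.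
have h2 : 18 * (E%:R - 2 * t) <= - t ^+ 2.
  have : 324 / t ^+ 2 * (E%:R - 2 * t) <= - 18 by lra.
  by rewrite mulrAC ler_pdivrMr ?exprn_gt0 //; lra.
have h3 : (#|T0| ^ 2 + 18 * E <= 36 * #|T0|)%N.
  rewrite -(ler_nat R) natrD natrX !natrM -/t; lra.
clearbody E; move: It h3 IA5.
move: (#|T0| ^ 2)%N #|I| #|T0| => s a b; lia.
Qed.

Lemma exists_large_valency (k : nat) (indk : forall I, independent e I -> (#|I| <= k)%N) :
  (7 * k < 2 * m)%N -> (36 * (k - 5) < (m - 73) ^ 2)%N ->
  exists x, (13 <= #|N x|)%N.
Proof.
move=> km1 km2.
(* Valencies at most 4 would give 2m <= 7k. *)
have [x x5] : exists x, (5 <= #|N x|)%N.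
  apply/existsP; rewrite -[[exists _, _]]negbK negb_exists; apply/negP => /forallP deg4.
  have [|I [/indk Ik]] := @triangle_free_card_bound _ e esym eirr 4 trif.
    by move=> x; have := deg4 x; rewrite -ltnNge ltnS.
  by rewrite card_ord; lia.
apply/existsP; rewrite -[[exists _, _]]negbK negb_exists; apply/negP => /forallP deg12.
have {}deg12 y : (#|N y| <= 12)%N by have := deg12 y; rewrite -ltnNge ltnS.
have [A [Ax A5]] := exists_subset_card x5.
(* [C] contains the five-leaf star and all neighbours of its vertices. If valencies are at most 12
   it has at most 1 + 12 + 5 * 12 = 73 vertices, and [far_from_star] bounds its complement. *)
pose C := x |: N x :|: \bigcup_(y in A) N y.
have cC : (#|C| <= 73)%N.
  have -> : 73%N = (1 + 12 + 60)%N by [].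
  apply: leq_trans (leq_card_setU _ _) _; apply: leq_add.
    by apply: leq_trans (leq_card_setU _ _) _; rewrite cards1 leq_add.
  apply: leq_trans (leq_card_bigcup _ _) _.
  have -> : 60%N = (\sum_(y in A) 12)%N by rewrite sum_nat_const A5.
  by apply: leq_sum => y _; exact: deg12.
have farC y : y \in x |: A -> [disjoint N y & ~: C].
  rewrite -subsets_disjoint => /setU1P[->|yA]; last first.
    by apply: subset_trans (subsetUr _ _); exact: bigcup_sup.
  by rewrite /C -setUA setUCA subsetUl.
have := far_from_star indk Ax A5 farC.
rewrite -subsets_disjoint => /(_ _).
have -> : x |: A \subset C.
  by apply: subset_trans (subsetUl _ _); exact: setUS.
move=> /(_ isT) h; apply/negP: km2; rewrite -leqNgt (leq_trans _ h) // leq_sqr.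
by rewrite leq_subLR -{1}(card_ord m) -(cardsC C) leq_add2r.
Qed.

Lemma graph_on_105_impossible :
  m = 105%N -> (forall x, (#|N x| <= 20)%N) -> (exists x, (13 <= #|N x|)%N) -> False.
Proof.
move=> m105 deg [x0 x13].
have m0 : (0 < m)%N by rewrite m105.
have mR : m%:R = 105 :> R by rewrite m105.
have [g [g0 g1 gmax]] := simplex_max L m0.
set theta := bil L g g in gmax.
pose G z := \sum_(j in N z) g 0 j.
have G0 z : 0 <= G z by apply: sumr_ge0.
have theta_le : theta <= 1 / 4 by have := psd g; rewrite g1 -/theta; lra.
have theta_ge : 1 / 6 <= theta.
  have [A [Ax A13]] := exists_subset_card x13.
  (* Weights 5/18 at the centre and 1/18 on each of 13 leaves sum to 1 and give (130 - 50 - 26)/324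
     = 1/6. *)
  have := gmax ((5 / 18) *: ind [set x0] + (1 / 18) *: ind A).
  rewrite bil_star // A13 coordsumD !coordsumZ !coordsum_ind cards1 A13.
  have -> : 5 / 18 * 1 + 1 / 18 * 13 = 1 :> R by field.
  move=> /(_ _ erefl) h; apply: le_trans (h _); first by lra.
  by move=> i; rewrite !mxE addr_ge0 // mulr_ge0 // ?ler0n //; lra.
pose delta : 'rV[R]_m := \row_z (theta - (G z - 2 * g 0 z)).
have GE z : G z = theta - delta 0 z + 2 * g 0 z by rewrite mxE; ring.
have bilg u : bil L u g = theta * coordsum u - \sum_z u 0 z * delta 0 z.
  rewrite bil_shifted_adj /coordsum mulr_sumr -sumrB; apply: eq_bigr => z _.
  by rewrite -/(G z) mxE; ring.
(* Moving from the maximiser [g] towards the vertex [z] cannot increase the form to first order. *)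
have delta0 z : 0 <= delta 0 z.
  suff: bil L (ind [set z]) g <= theta.
    by rewrite bilg sum_ind big_set1 coordsum_ind cards1; lra.
  apply: (@first_order_condition _ _ _ (bil L (ind [set z]) (ind [set z]))) => t /andP[t0 t1].
  have := gmax ((1 - t) *: g + t *: ind [set z]).
  rewrite coordsumD !coordsumZ g1 coordsum_ind cards1.
  rewrite bilDl !bilDr !bilZl !bilZr (bilC g _ shifted_adj_sym) -/theta.
  have -> : (1 - t) * 1 + t * 1 = 1 by ring.
  move=> /(_ _ erefl) h; apply: le_trans (h _); first by lra.
  by move=> i; rewrite !mxE addr_ge0 // mulr_ge0 // ?ler0n //; lra.
have gdelta z : g 0 z * delta 0 z = 0.
  have gd0 : \sum_z g 0 z * delta 0 z = 0.
    by have := bilg g; rewrite g1 -/theta; lra.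
  by rewrite (psumr_eq0P _ gd0) // => j _; rewrite mulr_ge0.
have delta_le z : delta 0 z <= theta.
  have [gz|gz] := eqVneq (g 0 z) 0.
    by have := G0 z; rewrite GE gz; lra.
  have := gdelta z => /eqP; rewrite mulf_eq0 (negPf gz) => /eqP ->; lra.
have key u : bil L u u <= theta * coordsum u ^+ 2
    - 2 * coordsum u * \sum_z u 0 z * delta 0 z.
  (* Subtracting [coordsum u] times [g] produces a vector of sum zero, where the form is
     nonpositive. *)
  have := psd (u + (- coordsum u) *: g).
  by rewrite bil_addZ ?shifted_adj_sym // coordsumD coordsumZ g1 bilg -/theta; lra.
set x := coordsum delta.
set Y := \sum_z delta 0 z ^+ 2.
pose khat := \sum_z g 0 z * #|N z|%:R.
have double (F : 'I_m -> R) :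
    \sum_y g 0 y * (\sum_(z in N y) F z) = \sum_z G z * F z.
  under eq_bigr do rewrite -sum_adj mulr_sumr.
  rewrite exchange_big; apply: eq_bigr => z _ /=.
  rewrite /G -sum_adj mulr_suml; apply: eq_bigr => y _.
  by rewrite esym; ring.
(* The [g]-mean of the valencies is the sum of all [G z], by exchanging the order of summation. *)
have khatE : khat = 2 + 105 * theta - x.
  rewrite /khat; under eq_bigr do rewrite -sum1_card natr_sum.
  rewrite double; under eq_bigr do rewrite mulr1 GE.
  rewrite big_split sumrB /= -mulr_sumr sumr_const card_ord -[theta *+ m]mulr_natr mR.
  by rewrite -/(coordsum g) -/(coordsum delta) g1 -/x; ring.
have const_mean c : c = \sum_z c * g 0 z.
  by rewrite -mulr_sumr -/(coordsum g) g1 mulr1.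
have khat_le : khat <= 20.
  rewrite [leRHS]const_mean; apply: ler_sum => z _.
  by rewrite [leRHS]mulrC ler_wpM2l // ler_nat.
have star : (12 - 49 * theta) * khat + 70 * (theta * x - Y) <= 50.
  have -> : theta * x - Y = \sum_y g 0 y * (\sum_(z in N y) delta 0 z).
    rewrite double /x /Y /coordsum mulr_sumr -sumrB; apply: eq_bigr => z _.
    by rewrite GE mulrDl -mulrA gdelta; ring.
  rewrite [leRHS]const_mean /khat !mulr_sumr -big_split /=.
  apply: ler_sum => y _; set k := #|N y|; set eta := \sum_(z in N y) _.
  have [gy|gy] := eqVneq (g 0 y) 0; first by rewrite gy; lra.
  have dy : delta 0 y = 0.
    by have /eqP := gdelta y; rewrite mulf_eq0 (negPf gy) => /eqP.
  have gy0 : 0 <= g 0 y by [].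
  suff : (12 - 49 * theta) * k%:R + 70 * eta <= 50 by nra.
  have [k0|k0] := posnP k.
    have -> : eta = 0 by rewrite /eta (cards0_eq k0) big_set0.
    by rewrite k0; lra.
  have k0' : 0 < k%:R :> R by rewrite ltr0n.
  (* This star has form value 12k^2/25 - 2k and total weight 7k/5; multiplying [key] by 25 and
     dividing by k gives the claim, since [delta] vanishes at [y]. *)
  have := key ((2 / 5 * k%:R) *: ind [set y] + 1 *: ind (N y)).
  rewrite bil_star // coordsumD !coordsumZ !coordsum_ind cards1 -/k.
  have -> : \sum_z ((2 / 5 * k%:R) *: ind [set y] + 1 *: ind (N y)) 0 z * delta 0 z
      = eta.
    rewrite (eq_bigr (fun z => 2 / 5 * k%:R * ((ind [set y] : 'rV[R]_m) 0 z * delta 0 z)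
      + (ind (N y) : 'rV[R]_m) 0 z * delta 0 z)) => [|z _]; last by rewrite !mxE; ring.
    by rewrite big_split -!mulr_sumr !sum_ind big_set1 dy /= -/eta; ring.
  move=> h; have : k%:R * ((12 - 49 * theta) * k%:R + 70 * eta - 50) <= 0 by lra.
  by rewrite pmulr_rle0 //; lra.
have theta0 : 0 < theta by lra.
apply: (@deficiency_infeasible _ theta x (Y / theta)) => //.
- rewrite ler_pdivrMr // /Y /x /coordsum mulr_suml; apply: ler_sum => z _.
  by rewrite expr2 ler_wpM2l.
- by lra.
- have -> : 70 * theta * (x - Y / theta) = 70 * (theta * x - Y).
    by field; exact: lt0r_neq0.
  by rewrite -khatE.
- have := key delta.
  (* The adjacency part of the form is nonnegative on the nonnegative vector [delta], leaving only
     the diagonal -2. *)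
  have : - (2 * Y) <= bil L delta delta.
    rewrite bil_shifted_adj /Y mulr_sumr -sumrN; apply: ler_sum => z _.
    have : 0 <= delta 0 z * \sum_(j in N z) delta 0 j.
      by rewrite mulr_ge0 // sumr_ge0.
    by lra.
  have -> : \sum_z delta 0 z * delta 0 z = Y by apply: eq_bigr => z _; rewrite expr2.
  rewrite -/x => h1 h2; rewrite -(pmulr_rge0 _ theta0).
  have -> : theta * (2 * (Y / theta) + x ^+ 2 - 2 * x * (Y / theta)) =
    2 * Y + theta * x ^+ 2 - 2 * x * Y by field; exact: lt0r_neq0.
  by lra.
Qed.

End Laplacian.

(** * From the switching class to the graph on U(x1, x2) *)

Section SwitchingClass.
Variables (R : realType) (n : nat) (S : 'M[R]_n).
Hypotheses (hS : seidel S).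
Local Notation SG := (switching_graph S).

Definition switch_sign (b : bool) : R := if b then 1 else -1.

(** The two copies of a vertex in the switching graph carry opposite signs. One copy of each vertex,
    chosen by [eps], induces the graph switched by these signs. *)
Definition signed_copy (eps : pred 'I_n) (i : 'I_n) : 'I_(n + n) :=
  if eps i then lshift n i else rshift n i.

Lemma signed_copy_inj eps : injective (signed_copy eps).
Proof.
move=> i j; rewrite /signed_copy; case: (eps i); case: (eps j).
- exact: lshift_inj.
- by move=> /eqP; rewrite eq_lrshift.
- by move=> /eqP; rewrite eq_rlshift.
- exact: rshift_inj.
Qed.

Lemma switching_graph_signed_copy eps i j :
  SG (signed_copy eps i) (signed_copy eps j) =
  (switch_sign (eps i) * S i j * switch_sign (eps j) == -1).
Proof.
have [_ Sd _] := hS.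
rewrite /switching_graph /seidel_graph /signed_copy.
have [->|ij] := eqVneq i j.
  case: (eps j).
    by rewrite block_mxEul Sd mulr0 mul0r.
  by rewrite block_mxEdr Sd mulr0 mul0r.
case: (eps i); case: (eps j); rewrite /switch_sign.
- by rewrite block_mxEul mul1r mulr1.
- by rewrite block_mxEur !mxE (negPf ij) mulr0n addr0 mul1r mulrN1.
- by rewrite block_mxEdl !mxE (negPf ij) mulr0n addr0 mulN1r mulr1.
- by rewrite block_mxEdr mulN1r mulrN1 opprK.
Qed.

Variables (W : {set 'I_n}) (H : rel 'I_n).
Local Notation D := (switching_diag R W).
Local Notation M := (D *m S *m D).
Hypothesis HE : H =2 seidel_graph M.

Lemma switchedE i j : M i j = switch_sign (i \in W) * S i j * switch_sign (j \in W).
Proof.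
by rewrite mul_mx_diag mxE mul_diag_mx !mxE.
Qed.

Lemma switchedE_graph i j : M i j = if i == j then 0 else 1 - 2 * (H i j)%:R.
Proof.
have [_ Sd Se] := hS; rewrite HE /seidel_graph switchedE.
case: eqVneq => [->|ij]; first by rewrite Sd mulr0 mul0r.
have N1 : (1 == -1 :> R) = false by apply/eqP; lra.
rewrite /switch_sign; case: (Se _ _ ij) => ->; case: (i \in W); case: (j \in W);
  by rewrite ?(mul1r, mulr1, mulrN1, opprK) ?N1 ?eqxx /=; ring.
Qed.

Lemma graph_sym : symmetric H.
Proof.
have [Ss _ _] := hS => i j; rewrite !HE /seidel_graph !switchedE.
have -> : S i j = S j i by rewrite -{1}Ss mxE.
by congr (_ == _); ring.
Qed.

Lemma graph_irr : irreflexive H.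
Proof.
have [_ Sd _] := hS => i; rewrite HE /seidel_graph switchedE Sd mulr0 mul0r.
by apply/eqP; lra.
Qed.

Lemma independent_signed_copy (A : {set 'I_n}) :
  independent H A -> (#|A| <= class_independence_number S)%N.
Proof.
move=> /independentP Aind; rewrite -(card_imset _ (@signed_copy_inj (mem W))).
apply: (@leq_bigmax_cond _ (independent SG) (fun B : {set _} => #|B|)).
apply/independentP => _ _ /imsetP[i iA ->] /imsetP[j jA ->].
by rewrite switching_graph_signed_copy -switchedE -/(seidel_graph _ _ _) -HE Aind.
Qed.

Variables (x1 x2 : 'I_n).
Hypothesis hadj : H x1 x2.
Local Notation U := (common_nonneighbours H x1 x2).

(* Flipping the copies of the vertices outside {x1, x2} makes U adjacent to
   both x1 and x2 in the switching graph. *)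
Lemma clique_signed_copy (B : {set 'I_n}) :
  B \subset U -> clique H B -> (#|B| + 2 <= class_clique_number S)%N.
Proof.
move=> /subsetP BU Bcl.
have x12 : x1 != x2 by apply: contraTneq hadj => ->; rewrite graph_irr.
have UE y : y \in B -> [/\ y != x1, y != x2, ~~ H y x1 & ~~ H y x2].
  move=> /BU; rewrite inE => /andP[h1 h2]; split=> //.
    by apply: contraNneq h2 => ->.
  by apply: contraNneq h1 => ->; rewrite graph_sym.
have Bx : (#|B| + 2)%N = #|B :|: [set x1; x2]|.
  rewrite cardsU cards2 x12.
  have -> : B :&: [set x1; x2] = set0; last by rewrite cards0 subn0.
  apply/setP => y; rewrite !inE; apply/negP => /andP[/UE[/negPf h1 /negPf h2 _ _]].
  by rewrite h1 h2.
pose eps i := (i \in W) (+) (i \notin [set x1; x2]).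
rewrite Bx -(card_imset _ (@signed_copy_inj eps)).
apply: (@leq_bigmax_cond _ (clique SG) (fun B : {set _} => #|B|)).
have SGE i j : i != j -> SG (signed_copy eps i) (signed_copy eps j) =
    H i j (+) (i \notin [set x1; x2]) (+) (j \notin [set x1; x2]).
  move=> ij; rewrite switching_graph_signed_copy.
  have sgn k : switch_sign (eps k) =
      switch_sign (k \in W) * switch_sign (k \in [set x1; x2]).
    rewrite /eps /switch_sign.
    by case: (k \in W); case: (k \in [set x1; x2]); rewrite /= ?(mulr1, mul1r, opprK, mulrN).
  have -> : switch_sign (eps i) * S i j * switch_sign (eps j) =
      M i j * (switch_sign (i \in [set x1; x2]) * switch_sign (j \in [set x1; x2])).
    by rewrite switchedE !sgn; ring.
  have N1 : (1 == -1 :> R) = false by apply/eqP; lra.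
  rewrite switchedE_graph (negPf ij) /switch_sign.
  case: (H i j); case: (i \in [set x1; x2]); case: (j \in [set x1; x2]) => /=;
    by [apply/eqP; lra | rewrite -N1; congr (_ == _); ring].
apply/forall_inP => _ /imsetP[i iA ->]; apply/forall_inP => _ /imsetP[j jA ->].
apply/implyP; rewrite (inj_eq (@signed_copy_inj eps)) => ij; rewrite SGE //.
have notx y : y \in B -> y \notin [set x1; x2].
  by move=> /UE[h1 h2 _ _]; rewrite !inE negb_or h1.
move/setUP: iA => [iB|ix]; move/setUP: jA => [jB|jx].
- rewrite !notx //= !addbT negbK.
  by move/forall_inP/(_ i iB)/forall_inP/(_ j jB): Bcl; rewrite ij.
- rewrite (notx _ iB) jx /= addbF addbT.
  by move: jx; rewrite !inE => /orP[/eqP->|/eqP->]; case: (UE _ iB).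
- rewrite (notx _ jB) ix /= addbF addbT.
  by move: ix; rewrite !inE => /orP[/eqP->|/eqP->]; rewrite graph_sym; case: (UE _ jB).
- rewrite ix jx /= !addbF; move: ix jx ij.
  by rewrite !inE => /orP[/eqP->|/eqP->] /orP[/eqP->|/eqP->]; rewrite ?eqxx // graph_sym.
Qed.

Hypothesis hmin : smallest_eigenvalue S (-5).

Lemma switched_psd v : 0 <= bil M v v + 5 * sqnorm v.
Proof.
have [Ss _ _] := hS; have := smallest_eigenvalue_bound Ss hmin (v *m D).
have -> : bil S (v *m D) (v *m D) = bil M v v.
  by rewrite /bil trmx_mul tr_diag_mx !mulmxA.
have -> : sqnorm (v *m D) = sqnorm v; last by lra.
apply: eq_bigr => i _; rewrite mul_mx_diag !mxE exprMn.
by case: (i \in W); rewrite ?sqrrN expr1n mulr1.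
Qed.

(* Adding -s/4 to the weights of x1 and x2, where s is the sum of the weights on
   U, is the orthogonal projection along the sum of the vectors of x1 and x2. *)
Lemma nonneighbours_psd m (f : 'I_m -> 'I_n) (u : 'rV[R]_m) :
  injective f -> (forall i, f i \in U) ->
  4 * bil (shifted_adj R (relpre f H)) u u <= coordsum u ^+ 2.
Proof.
move=> finj fU.
have x12 : x1 != x2 by apply: contraTneq hadj => ->; rewrite graph_irr.
have fx i : [/\ f i != x1, f i != x2, ~~ H (f i) x1 & ~~ H (f i) x2].
  have := fU i; rewrite inE => /andP[h1 h2]; split=> //.
    by apply: contraNneq h2 => ->.
  by apply: contraNneq h1 => ->; rewrite graph_sym.
pose M5 := M + 5%:M.
have M5E i j : M5 i j = M i j + 5 * (i == j)%:R.
  by rewrite [LHS]mxE [in X in _ + X]mxE mulr_natr.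
have M5sym : M5^T = M5.
  by apply/matrixP => i j; rewrite mxE !M5E !switchedE_graph eq_sym graph_sym.
have M5psd v : 0 <= bil M5 v v.
  suff -> : bil M5 v v = bil M v v + 5 * sqnorm v by exact: switched_psd.
  rewrite sqnormE /bil /M5 mulmxDr mulmxDl [LHS]mxE mul_mx_scalar -scalemxAl mulmx1.
  by congr (_ + _); rewrite mxE.
have ind1 i j : bil M5 (ind [set i]) (ind [set j]) = M5 i j.
  by rewrite bil_ind !big_set1.
pose w := \sum_i u 0 i *: (ind [set f i] : 'rV[R]_n).
pose y : 'rV[R]_n := ind [set x1] + ind [set x2].
have := M5psd (w + (- (coordsum u / 4)) *: y).
rewrite bil_addZ //.
(* [y] has norm 5 + 5 - 1 - 1 = 8 and product 2 with every vertex of U, whence the coefficient 2s/8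
   = s/4. *)
have -> : bil M5 y y = 8.
  rewrite /y bilDl !bilDr !ind1 !M5E !switchedE_graph !eqxx (negPf x12) eq_sym (negPf x12).
  have h21 : H x2 x1 by rewrite graph_sym.
  by rewrite hadj h21 /=; ring.
have -> : bil M5 w y = 2 * coordsum u.
  rewrite /w bil_suml /coordsum mulr_sumr; apply: eq_bigr => i _.
  have [/negPf h1 /negPf h2 /negPf h3 /negPf h4] := fx i.
  by rewrite /y bilDr !ind1 !M5E !switchedE_graph h1 h2 h3 h4 /=; ring.
(* On U the matrix [M5] is J - 2L; the diagonal agrees because 5 = 1 - 2(-2). *)
have -> : bil M5 w w = coordsum u ^+ 2 - 2 * bil (shifted_adj R (relpre f H)) u u.
  rewrite /w bil_suml bilE expr2 {1}/coordsum mulr_suml mulr_sumr -sumrB.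
  apply: eq_bigr => i _; rewrite bil_sumr /coordsum !mulr_sumr -sumrB.
  apply: eq_bigr => j _; rewrite ind1 M5E switchedE_graph mxE (inj_eq finj) /=.
  have [->|ij] := eqVneq i j; first by rewrite graph_irr /=; ring.
  by rewrite /=; ring.
by lra.
Qed.

Hypotheses (halpha : (class_independence_number S <= 28)%N).
Hypotheses (homega : class_clique_number S = 4%N).
Hypothesis hbmax : (max_valency (nonneighbour_graph H x1 x2) <= 20)%N.

Lemma common_nonneighbours_lt105 : (#|U| < 105)%N.
Proof.
rewrite ltnNge; apply/negP => U105.
have [V [_ V105]] : exists V : {set {y | y \in U}}, V \subset setT /\ #|V| = 105%N.
  apply: exists_subset_card; rewrite cardsT card_sig.
  by rewrite (leq_trans U105) //; apply: subset_leq_card; apply/subsetP.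
pose g (i : 'I_#|V|) := enum_val i; pose f i := val (g i).
have finj : injective f by move=> i j /val_inj /enum_val_inj.
have fU i : f i \in U by exact: valP (g i).
pose e : rel 'I_#|V| := relpre f H.
have esym : symmetric e by move=> i j; exact: graph_sym.
have eirr : irreflexive e by move=> i; exact: graph_irr.
(* A triangle in U, joined with x1 and x2, would give a clique of size 5 in the switching graph. *)
have trif i j k : e i j -> e j k -> ~~ e i k.
  move=> ij jk; apply/negP => ik.
  have neq a b : e a b -> a != b by apply: contraTneq => ->; rewrite eirr.
  pose B := [set i; j; k].
  have Bcl : clique H (f @: B).
    apply/forall_inP => _ /imsetP[a aB ->]; apply/forall_inP => _ /imsetP[b bB ->].
    apply/implyP; rewrite (inj_eq finj) -/(e a b); move: aB bB.
    have [ji [kj ki]] : e j i /\ e k j /\ e k i by rewrite !(esym k) esym.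
    by rewrite !inE -!orbA => /or3P[] /eqP -> /or3P[] /eqP ->; rewrite ?eqxx.
  have BU : f @: B \subset U by apply/subsetP => _ /imsetP[a _ ->].
  have := clique_signed_copy BU Bcl; rewrite homega (card_imset _ finj) /B.
  rewrite setUC cardsU1 cards2 !inE negb_or.
  by rewrite (eq_sym k i) (eq_sym k j) (neq _ _ ij) (neq _ _ ik) (neq _ _ jk).
(* Adding x1 to an independent subset of U keeps it independent, so the bound drops from 28 to
   27. *)
have indk I : independent e I -> (#|I| <= 27)%N.
  move=> /independentP Iind.
  have x1I : x1 \notin f @: I.
    apply/imsetP => -[i _ x1f]; have := fU i.
    by rewrite -x1f inE hadj andbF.
  have : independent H (x1 |: f @: I).
    apply: independentU1.
    - exact: graph_sym.
    - exact: graph_irr.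
    - by apply/independentP => _ _ /imsetP[i iI ->] /imsetP[j jI ->]; exact: Iind.
    - apply/setP => y; rewrite !inE; apply/negP => /andP[x1y /imsetP[i _ yf]].
      by have := fU i; rewrite -yf inE graph_sym x1y.
  move=> /independent_signed_copy /leq_trans /(_ halpha).
  by rewrite cardsU1 x1I card_imset.
have deg i : (#|nbrs e i| <= 20)%N.
  apply: leq_trans hbmax.
  apply: leq_trans (leq_bigmax (g i)).
  have ginj : injective g by exact: enum_val_inj.
  rewrite -(card_imset _ ginj) /valency; apply: subset_leq_card.
  by apply/subsetP => _ /imsetP[j ij ->]; rewrite inE in ij; rewrite inE.
have psd u : 4 * bil (shifted_adj R e) u u <= coordsum u ^+ 2.
  exact: nonneighbours_psd.
apply: (graph_on_105_impossible esym eirr trif psd) => //.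
(* Numerically, 7 * 27 = 189 < 210 and 36 * 22 = 792 < 32^2 = 1024. *)
by apply: (exists_large_valency esym eirr trif psd indk); rewrite V105.
Qed.

End SwitchingClass.

Unset Implicit Arguments.

Theorem theorem9p2 (R : realType) (n : nat) (S : 'M[R]_n)
  (hn : (277 <= n)%N)
  (hS : seidel S)
  (hmin : smallest_eigenvalue S (-5))
  (halpha : (class_independence_number S <= 28)%N)
  (homega : class_clique_number S = 4%N)
  (H : rel 'I_n)
  (hH : in_switching_class S H)
  (x1 x2 : 'I_n)
  (hadj : H x1 x2)
  (hcommon : ~ exists z, H z x1 /\ H z x2)
  (hbmax : (max_valency (nonneighbour_graph H x1 x2) <= 20)%N) :
  (#|common_nonneighbours H x1 x2| <= 105)%N /\
  (#|common_nonneighbours H x1 x2| = 105%N ->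
   exists u v : {y : 'I_n | y \in common_nonneighbours H x1 x2},
     [/\ nonneighbour_graph H x1 x2 u v,
         valency (nonneighbour_graph H x1 x2) u = 20%N
       & valency (nonneighbour_graph H x1 x2) v = 20%N]).
Proof.
have [W HE] := hH.
have := common_nonneighbours_lt105 hS HE hadj hmin halpha homega hbmax.
by move=> U105; split=> [|U105']; [exact: ltnW | rewrite U105' in U105].
Qed.
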